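(* For all $n\ge1$ and all $\sigma\in S_n(321)$, $(\mathrm{fp},\mathrm{exc},\mathrm{crs})(\Theta(\sigma))=(\mathrm{fp},\mathrm{exc},\mathrm{crs})(\sigma)$; i.e. $\Theta$ preserves the number of fixed points, of excedances and of crossings.
   Context: $S_n(\tau)$: permutations of $[n]$ avoiding the pattern $\tau$. For $\sigma\in S_n$: $\mathrm{fp}(\sigma)=|\{i:\sigma(i)=i\}|$, $\mathrm{exc}(\sigma)=|\{i:\sigma(i)>i\}|$; a crossing is a pair $(i,j)$ with $i<j<\sigma(i)<\sigma(j)$ or $\sigma(i)<\sigma(j)\le i<j$, and $\mathrm{crs}(\sigma)$ is their number. Definition of $\Theta$: for $\sigma\in S_n(321)$ let $(P,Q)$ be the insertion and recording tableaux of the RSK correspondence applied to $\sigma$ (at most two rows). $\Psi(\sigma)$ is the path of $2n$ steps $u=(1,1)$, $d=(1,-1)$ whose first $n$ steps are, for $i=1,\dots,n$, $u$ if $i$ is in the first row of $P$ and $d$ if in the second, and whose last $n$ steps are, for $j=n,\dots,1$, $u$ if $j$ is in the second row of $Q$ and $d$ if in the first; it is a Dyck path. Each up-step is matched with the first later down-step ending at the height where the up-step starts. Labelling up-steps left to right $n,\dots,1$ and down-steps left to right $1,\dots,n$, $\Phi^{-1}(D)$ sends each up-step label to the label of its matched down-step; it is a bijection onto $S_n(132)$. $\Theta=\Phi^{-1}\circ\Psi$. *)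

(* Defs.v *)
From mathcomp Require Import all_boot all_order all_fingroup all_algebra.

Set Implicit Arguments.
Unset Strict Implicit.
Unset Printing Implicit Defensive.

(* Permutations of [n] are elements of 'S_n: positions, values, tableau entries
   and step labels all run over 0, ..., n-1 instead of 1, ..., n. *)

Definition contains (k n : nat) (tau : 'S_k) (s : 'S_n) : Prop :=
  exists f : 'I_k -> 'I_n,
    (forall a b : 'I_k, a < b -> f a < f b) /\
    (forall a b : 'I_k, (s (f a) < s (f b)) = (tau a < tau b)).

Definition avoids (k n : nat) (tau : 'S_k) (s : 'S_n) : Prop :=
  ~ contains tau s.

Definition pat321 : 'S_3 := perm (@rev_ord_inj 3).

Definition fp (n : nat) (s : 'S_n) : nat := #|[set i : 'I_n | s i == i]|.

Definition exc (n : nat) (s : 'S_n) : nat := #|[set i : 'I_n | i < s i]|.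

Definition crossing (n : nat) (s : 'S_n) (i j : 'I_n) : bool :=
  [&& i < j, j < s i & s i < s j] || [&& s i < s j, s j <= i & i < j].

Definition crs (n : nat) (s : 'S_n) : nat :=
  #|[set p : 'I_n * 'I_n | crossing s p.1 p.2]|.

(* A tableau is the sequence of its rows, top row first. *)
Definition tableau := seq (seq nat).

(* New row, together with the bumped entry if there is one. *)
Fixpoint row_insert (r : seq nat) (x : nat) : seq nat * option nat :=
  if r is y :: r' then
    if x < y then (x :: r', Some y)
    else let: (r'', b) := row_insert r' x in (y :: r'', b)
  else ([:: x], None).

(* New tableau, together with the index of the row that gained a cell. *)
Fixpoint tab_insert (t : tableau) (x : nat) : tableau * nat :=
  if t is r :: t' then
    let: (r', b) := row_insert r x in
    if b is Some y then
      let: (t'', k) := tab_insert t' y in (r' :: t'', k.+1)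
    else (r' :: t', 0)
  else ([:: [:: x]], 0).

Definition add_cell (t : tableau) (k x : nat) : tableau :=
  set_nth [::] t k (rcons (nth [::] t k) x).

Definition rsk_step (PQ : tableau * tableau) (jx : nat * nat) :
    tableau * tableau :=
  let: (P, k) := tab_insert PQ.1 jx.2 in (P, add_cell PQ.2 k jx.1).

Definition rsk (w : seq nat) : tableau * tableau :=
  foldl rsk_step ([::], [::]) (zip (iota 0 (size w)) w).

Definition word (n : nat) (s : 'S_n) : seq nat :=
  [seq nat_of_ord (s i) | i <- enum 'I_n].

(* A lattice path is a sequence of booleans: true is u = (1, 1) and false is
   d = (1, -1). *)
Definition path_of_tableaux (n : nat) (P Q : tableau) : seq bool :=
  [seq i \in nth [::] P 0 | i <- iota 0 n] ++
  [seq j \in nth [::] Q 1 | j <- rev (iota 0 n)].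

Definition Psi (n : nat) (s : 'S_n) : seq bool :=
  let: (P, Q) := rsk (word s) in path_of_tableaux n P Q.

Definition is_up (D : seq bool) (p : nat) : bool :=
  (p < size D) && nth false D p.

Definition is_down (D : seq bool) (p : nat) : bool :=
  (p < size D) && ~~ nth false D p.

Definition ups_before (D : seq bool) (p : nat) : nat :=
  count_mem true (take p D).

Definition downs_before (D : seq bool) (p : nat) : nat :=
  count_mem false (take p D).

Definition height (D : seq bool) (p : nat) : int :=
  ((ups_before D p)%:Z - (downs_before D p)%:Z)%R.

(* Position of the first down-step after the up-step at position p that ends at
   the height where that up-step starts (size D if there is none). *)
Definition mate (D : seq bool) (p : nat) : nat :=
  head (size D)
    [seq q <- iota p.+1 (size D - p.+1)
       | is_down D q && (height D q.+1 == height D p)].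

(* With n up-steps, the up-step preceded by m up-steps is the (m+1)-st from the
   left, so its 0-based label is n - 1 - m. *)
Definition up_label (n : nat) (D : seq bool) (p : nat) : nat :=
  n - (ups_before D p).+1.

Definition down_label (D : seq bool) (q : nat) : nat := downs_before D q.

(* Position of the up-step labelled i. *)
Definition up_pos (n : nat) (D : seq bool) (i : nat) : nat :=
  head (size D)
    [seq p <- iota 0 (size D) | is_up D p && (up_label n D p == i)].

Definition Phi_inv_val (n : nat) (D : seq bool) (i : nat) : nat :=
  down_label D (mate D (up_pos n D i)).

(* For a Dyck path D of 2n steps, Phi_inv_val n D is a bijection of
   {0, ..., n-1}, so neither the default value i nor the default permutation 1
   is used. *)
Definition Phi_inv (n : nat) (D : seq bool) : 'S_n :=
  insubd (1%g : 'S_n)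
    [ffun i : 'I_n => insubd i (Phi_inv_val n D i)].

Definition Theta (n : nat) (s : 'S_n) : 'S_n := Phi_inv n (Psi s).

(* Main.v *)
(* Induct on n by deleting the maximum of s, at position p. On the RSK side this
   deletes from Psi s the peak "ud" whose down-step encodes position p, and 321
   avoidance forces the path to go down and then up between its middle and that
   peak. On the side of Phi_inv it deletes a point (a, b) with b - a = n - p,
   where n is the deleted value. In both permutations every point to the
   lower right of the deleted one is an anti-excedance, and for any permutation
   with this property the deletion of (a, b), a <= b, changes exc by [a < b] and
   crs by max(b - a - 1, 0). Finally, s i = i exactly when the
   tunnel starting at step i is centred on the middle of the path. *)
Require Import Defs.
From mathcomp Require Import all_boot all_order all_fingroup all_algebra.
From mathcomp Require Import zify.

Set Implicit Arguments.
Unset Strict Implicit.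
Unset Printing Implicit Defensive.

Lemma fp_sum n (s : 'S_n) : fp s = \sum_i (s i == i).
Proof. by rewrite /fp cardsE -sum1_card big_mkcond. Qed.

Lemma exc_sum n (s : 'S_n) : exc s = \sum_(i < n) (i < s i).
Proof. by rewrite /exc cardsE -sum1_card big_mkcond. Qed.

Lemma crs_sum n (s : 'S_n) : crs s = \sum_i \sum_j crossing s i j.
Proof.
by rewrite /crs cardsE -sum1_card big_mkcond pair_bigA; apply: eq_bigr => -[].
Qed.

Lemma sum_perm_eq n (t : 'S_n) (v : 'I_n) (P : pred 'I_n) :
  \sum_j ((t j == v) && P j) = P ((t^-1)%g v).
Proof.
rewrite (bigD1 ((t^-1)%g v)) //= permKV eqxx big1 ?addn0 // => j.
by rewrite -(inj_eq (@perm_inj _ t)) permKV => /negbTE ->.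
Qed.

Lemma sum_interval n a b : b <= n -> \sum_(i < n) ((a <= i) && (i < b)) = b - a.
Proof.
move=> le_bn; rewrite -(big_mkord xpredT (fun i => nat_of_bool ((a <= i) && (i < b)))).
rewrite (big_cat_nat (n := b)) //= [X in _ + X]big_nat_cond [X in _ + X]big1 ?addn0; last first.
  by move=> i; lia.
elim: b le_bn => [|b IHb] le_bn; first by rewrite big_geq.
have [lt_ba|le_ab] := ltnP b a.
  rewrite big_nat_cond big1 => [|i]; lia.
rewrite big_nat_recr //= -[RHS]/(b.+1 - a) subSn // ltnSn le_ab addn1.
rewrite -IHb; last by lia.
by congr _.+1; apply: eq_big_nat => i; lia.
Qed.

Definition crossing_at (i j u v : nat) : bool :=
  [&& i < j, j < u & u < v] || [&& u < v, v <= i & i < j].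

(* The correction terms are the pairs of arcs that start or cease to cross when
   the row [a] and the column [b] are inserted between them. *)
Lemma crossing_at_bump a b i j u v : a <= b ->
    (a <= i -> u < b -> u <= i) -> (a <= j -> v < b -> v <= j) ->
  crossing_at (bump a i) (bump a j) (bump b u) (bump b v)
    + [&& i < a <= j, u < b <= v & u == j.+1]
  = crossing_at i j u v + [&& a <= i, a <= j, u < b, v < b & v == i.+1].
Proof.
rewrite /crossing_at /bump ![b <= _]leqNgt ![_ < a]ltnNge => le_ab.
have [ai|ai] := leqP a i; have [aj|aj] := leqP a j;
  have [ub|ub] := ltnP u b; have [vb|vb] := ltnP v b => /=; move=> Hi Hj;
  rewrite ?add1n ?add0n ?andbF ?addn0 /=; lia.
Qed.

Section InsertPoint.

Variables (n : nat) (t : 'S_n) (a b : 'I_n.+1).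
Hypothesis le_ab : a <= b.
Hypothesis below : forall k : 'I_n, a <= k -> t k < b -> t k <= k.

Let lift_permE k : lift_perm a b t (lift a k) = lift b (t k).
Proof. exact: lift_perm_lift. Qed.

Lemma exc_lift_perm : exc (lift_perm a b t) = exc t + (a < b).
Proof.
rewrite !exc_sum (bigD1_ord a) //= lift_perm_id addnC; congr (_ + _).
apply: eq_bigr => k _; rewrite lift_permE /= /bump.
by have := @below k; lia.
Qed.

Lemma crossing_lift_perm i j :
  crossing (lift_perm a b t) (lift a i) (lift a j)
    + [&& i < a <= j, t i < b <= t j & t i == j.+1 :> nat]
  = crossing t i j + [&& a <= i, a <= j, t i < b, t j < b & t j == i.+1 :> nat].
Proof.
by rewrite -(crossing_at_bump le_ab (@below i) (@below j)) /crossing !lift_permE.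
Qed.

Lemma fixed_lift_perm k : (lift_perm a b t (lift a k) == lift a k)
  = (t k == k) && ((k < a) || (b <= k)).
Proof.
rewrite lift_permE -!val_eqE /= /bump.
by have := @below k; lia.
Qed.

Let mid (i : 'I_n) := (a <= i) && (i < b.-1).

Let sum_new_row : \sum_j crossing (lift_perm a b t) a (lift a j)
  = \sum_i (mid i && (b <= t i)).
Proof.
apply: eq_bigr => j _; rewrite /mid /crossing lift_perm_id lift_permE /= /bump.
by have := @below j; lia.
Qed.

Let sum_new_col : \sum_j crossing (lift_perm a b t) (lift a j) a
  = \sum_(i < n) \sum_(j < n) [&& mid i, j < a & t j == i.+1 :> nat].
Proof.
rewrite exchange_big; apply: eq_bigr => /= j _.
have -> : crossing (lift_perm a b t) (lift a j) a = [&& j < a, a < t j & t j < b].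
  rewrite /crossing lift_perm_id lift_permE /= /bump.
  by have := @below j; lia.
rewrite /mid; have [/and3P[ja ta tb]|no] := boolP [&& _, _ & _]; last first.
  rewrite big1 // => i _; apply/eqP; rewrite eqb0; apply: contra no.
  by case/and3P=> /andP[ai ib] -> /eqP->; rewrite ltnS ai /=; lia.
have lt_i : (t j).-1 < n by rewrite (leq_ltn_trans (leq_pred _)).
rewrite (bigD1 (Ordinal lt_i)) //= big1 => [|i].
  by rewrite prednK ?(leq_ltn_trans _ ta) // eqxx ja; lia.
rewrite -val_eqE /= => ne; apply/eqP; rewrite eqb0; apply: contra ne.
by case/and3P=> _ _ /eqP->.
Qed.

Lemma crs_lift_perm : crs (lift_perm a b t) = crs t + (b - a).-1.
Proof.
have le_bn : b <= n by rewrite -ltnS.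
rewrite !crs_sum (bigD1_ord a) //= (bigD1_ord a) //=.
under [X in _ + X]eq_bigr => i _ do rewrite (bigD1_ord a) //=.
rewrite big_split /= sum_new_row sum_new_col.
have -> : crossing (lift_perm a b t) a a = false by rewrite /crossing; lia.
pose G (i j : 'I_n) := [&& i < a <= j, t i < b <= t j & t i == j.+1 :> nat].
pose E (i j : 'I_n) := [&& a <= i, a <= j, t i < b, t j < b & t j == i.+1 :> nat].
have eqC : \sum_i \sum_j crossing (lift_perm a b t) (lift a i) (lift a j)
    + \sum_i \sum_j G j i = \sum_i \sum_j crossing t i j + \sum_i \sum_j E i j.
  rewrite [X in _ + X]exchange_big -!big_split; apply: eq_bigr => i _ /=.
  by rewrite -!big_split; apply: eq_bigr => j _ /=; apply: crossing_lift_perm.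
(* Each v with a < v < b contributes exactly 1, in every one of the four cases
   according to the sides of [a] and [b] on which its image and preimage lie. *)
have eqI : \sum_i (mid i && (b <= t i))
      + \sum_(i < n) \sum_(j < n) [&& mid i, j < a & t j == i.+1 :> nat]
      + \sum_i \sum_j E i j
    = (b - a).-1 + \sum_i \sum_j G j i.
  have -> : (b - a).-1 = \sum_i mid i by rewrite sum_interval; lia.
  rewrite -!big_split; apply: eq_bigr => i _ /=.
  have [mid_i|mid'i] := boolP (mid i); last first.
    rewrite !big1 //= => j _; rewrite /G /E; move: mid'i; rewrite /mid; lia.
  have lt_i : i.+1 < n by move: mid_i; rewrite /mid; lia.
  have sumP (P : pred 'I_n) (F : 'I_n -> bool) :
      (forall j, F j = (t j == Ordinal lt_i) && P j) ->
      \sum_j F j = P ((t^-1)%g (Ordinal lt_i)).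
    by move=> FE; under eq_bigr => j _ do rewrite FE; apply: sum_perm_eq.
  rewrite (sumP (fun j => j < a)) => [|j]; last by rewrite -val_eqE /= andbC.
  rewrite (sumP (fun j => (a <= j) && (t i < b)) (E i)) => [|j]; last first.
    by rewrite /E -val_eqE /=; move: mid_i; rewrite /mid; lia.
  rewrite (sumP (fun j => (j < a) && (b <= t i)) (G^~ i)) => [|j]; last first.
    by rewrite /G -val_eqE /=; move: mid_i; rewrite /mid; lia.
  by lia.
have arith x1 x2 x3 g e c m :
  x3 + g = c + e -> x1 + x2 + e = m + g -> x1 + (x2 + x3) = c + m by lia.
by rewrite add0n; apply: arith eqC eqI.
Qed.

End InsertPoint.

Definition ins_tab (T : tableau) (w : seq nat) : tableau :=
  foldl (fun T' x => (tab_insert T' x).1) T w.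

Fixpoint ins_rows (T : tableau) (w : seq nat) : seq nat :=
  if w is x :: w' then (tab_insert T x).2 :: ins_rows (tab_insert T x).1 w'
  else [::].

Lemma ins_tab_cat T w1 w2 : ins_tab T (w1 ++ w2) = ins_tab (ins_tab T w1) w2.
Proof. exact: foldl_cat. Qed.

Lemma ins_rows_cat T w1 w2 :
  ins_rows T (w1 ++ w2) = ins_rows T w1 ++ ins_rows (ins_tab T w1) w2.
Proof. by elim: w1 T => //= x w1 IHw T; rewrite IHw. Qed.

Lemma size_ins_rows T w : size (ins_rows T w) = size w.
Proof. by elim: w T => //= x w IHw T; rewrite IHw. Qed.

Lemma rsk_foldl w T Q j (st := foldl rsk_step (T, Q) (zip (iota j (size w)) w)) :
  st.1 = ins_tab T w /\
  forall r, nth [::] st.2 r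
    = nth [::] Q r ++ [seq i <- iota j (size w) | nth 0 (ins_rows T w) (i - j) == r].
Proof.
rewrite {}/st; elim: w T Q j => [|x w IHw] T Q j /=; first by split=> // r; rewrite cats0.
rewrite /rsk_step /= -/rsk_step; case Ex: (tab_insert T x) => [T' k] /=.
have [-> IHr] := IHw T' (add_cell Q k j) j.+1; split=> // r.
have -> : [seq i <- iota j.+1 (size w) | nth 0 (k :: ins_rows T' w) (i - j) == r]
   = [seq i <- iota j.+1 (size w) | nth 0 (ins_rows T' w) (i - j.+1) == r].
  apply: eq_in_filter => i; rewrite mem_iota => /andP[lt_ji _].
  by rewrite -(subnSK lt_ji).
rewrite IHr subnn /= /add_cell nth_set_nth /= [r == k]eq_sym.
by case: eqP => [->|_]; rewrite ?cat_rcons.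
Qed.

Lemma size_word n (s : 'S_n) : size (word s) = n.
Proof. by rewrite size_map size_enum_ord. Qed.

Lemma ins_rows_row0 w : ins_rows [::] w = ins_rows [:: [::]] w.
Proof. by case: w. Qed.

Lemma ins_tab_row0 w : nth [::] (ins_tab [::] w) 0 = nth [::] (ins_tab [:: [::]] w) 0.
Proof. by case: w. Qed.

(* The empty tableau is replaced by the equivalent one whose first row is empty,
   so that every tableau in sight has a first row. *)
Lemma PsiE n (s : 'S_n) :
  Psi s = [seq i \in nth [::] (ins_tab [:: [::]] (word s)) 0 | i <- iota 0 n]
    ++ rev [seq k == 1 | k <- ins_rows [:: [::]] (word s)].
Proof.
rewrite /Psi /rsk; have [] := rsk_foldl (word s) [::] [::] 0.
case: foldl => [P Q] /= -> Qrow; rewrite /path_of_tableaux ins_tab_row0.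
congr (_ ++ _); rewrite map_rev; congr rev.
apply: (@eq_from_nth _ false); first by rewrite !size_map size_iota size_ins_rows size_word.
move=> i; rewrite size_map size_iota => lt_in.
rewrite (nth_map 0) ?size_ins_rows ?size_word //.
rewrite (nth_map 0) ?size_iota // nth_iota //.
by rewrite Qrow nth_nil mem_filter mem_iota size_word ins_rows_row0 subn0 add0n lt_in /= andbT.
Qed.

Lemma row_insert_append r x : all (leq^~ x) r -> row_insert r x = (rcons r x, None).
Proof.
by elim: r => //= y r IHr /andP[le_yx /IHr ->]; rewrite ltnNge le_yx.
Qed.

Lemma row_insertP r x :
  (all (leq^~ x) r /\ row_insert r x = (rcons r x, None))
  \/ (exists r' y, [/\ row_insert r x = (r', Some y), y \in r,
      {subset r' <= x :: r} & forall M, x < M ->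
      row_insert (rcons r M) x = (rcons r' M, Some y)]).
Proof.
have [le_rx|] := boolP (all (leq^~ x) r); first by left; rewrite row_insert_append.
right; elim: r i => //= y r IHr.
rewrite negb_and -ltnNge; have [lt_xy _|le_yx /= /IHr] := ltnP x y.
  exists (x :: r), y; split; rewrite ?inE ?eqxx // => z; rewrite !inE.
  by case/orP=> ->; rewrite ?orbT.
case=> r' [z [-> zr sr' rM]]; exists (y :: r'), z; split=> //.
- by rewrite inE zr orbT.
- by move=> u; rewrite !inE => /orP[->|/sr'/[!inE]/orP[->|->]]; rewrite ?orbT.
- by move=> M /rM ->.
Qed.

Definition entries_below M (T : tableau) := all (all (ltn^~ M)) T.

Lemma entries_below_insert M T x :
  entries_below M T -> x < M -> entries_below M (tab_insert T x).1.
Proof.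
elim: T x => [|r T IHT] x /=; first by move=> _ ->.
case/andP=> rM TM xM; have [[_ ->] /=|[r' [y [-> yr sr' _]]]] := row_insertP r x.
  by rewrite all_rcons /= xM rM.
have := IHT y TM (allP rM _ yr); case: (tab_insert T y) => [T' k] /= ->.
rewrite andbT; apply/allP=> z /sr'; rewrite inE => /predU1P[->//|]; exact: (allP rM).
Qed.

Lemma entries_below_ins_tab M T w :
  entries_below M T -> all (ltn^~ M) w -> entries_below M (ins_tab T w).
Proof.
elim: w T => //= x w IHw T TM /andP[xM wM]; apply: IHw => //.
exact: entries_below_insert.
Qed.

Lemma tab_insert_max M T : entries_below M T -> (tab_insert T M).2 = 0.
Proof.
case: T => //= r T /andP[rM _]; rewrite row_insert_append //.
by apply: sub_all rM => y; apply: ltnW.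
Qed.

Lemma tab_insert_cons r T x : exists r' T', (tab_insert (r :: T) x).1 = r' :: T'.
Proof.
rewrite /=; case: row_insert => r' [y|]; last by exists r', T.
by case: tab_insert => T' k; exists r', T'.
Qed.

Lemma ins_tab_cons r T w : exists r' T', ins_tab (r :: T) w = r' :: T'.
Proof.
elim: w r T => [|x w IHw] r T; first by exists r, T.
rewrite -[x :: w]cat1s ins_tab_cat; have [r1 [T1 /= ->]] := tab_insert_cons r T x.
exact: IHw.
Qed.

Lemma ins_increasing r T x w : all (leq^~ x) r -> path ltn x w ->
  ins_tab (r :: T) w = (r ++ w) :: T /\ ins_rows (r :: T) w = nseq (size w) 0.
Proof.
elim: w r x => [|y w IHw] r x rx /=; first by rewrite cats0.
case/andP=> lt_xy yw.
have ry : all (leq^~ y) r by apply: sub_all rx => z /leq_trans; apply; apply: ltnW.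
rewrite row_insert_append //=.
have [||-> ->] := IHw (rcons r y) y; rewrite ?cat_rcons //.
by rewrite all_rcons /= leqnn.
Qed.

(* The entries of [w] first bump entries of the first row and leave [M] in
   place; the first one that would be appended bumps [M] instead. *)
Lemma ins_after_max M r T w : entries_below M (r :: T) -> all (ltn^~ M) w ->
  sorted ltn w ->
  exists R k,
  [/\ ins_rows (r :: T) w = R ++ nseq k 0, all (leq 1) R,
      ins_rows (rcons r M :: T) w = R ++ (if k is k'.+1 then 1 :: nseq k' 0 else [::]),
      forall i, i < M -> (i \in nth [::] (ins_tab (rcons r M :: T) w) 0)
                       = (i \in nth [::] (ins_tab (r :: T) w) 0)
    & (M \in nth [::] (ins_tab (rcons r M :: T) w) 0) = (k == 0)].
Proof.
elim: w r T => [|x w IHw] r T rTM /=.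
  exists [::], 0; split=> //=; last by rewrite mem_rcons inE eqxx.
  by move=> i iM; rewrite mem_rcons inE ltn_eqF.
case/andP=> xM wM xw; have wS := path_sorted xw.
have [[rx rE]|[r' [y [rE yr sr' rM]]]] := row_insertP r x.
  have rME : row_insert (rcons r M) x = (rcons r x, Some M).
    elim: r rx {rE rTM} => /= [_|z r IHr /andP[zx /IHr->]]; first by rewrite xM.
    by rewrite ltnNge zx.
  have /andP[_ TM] := rTM.
  rewrite rE rME /=; have := tab_insert_max TM.
  case: tab_insert => T' k /= ->.
  have rx' : all (leq^~ x) (rcons r x) by rewrite all_rcons leqnn.
  have [-> ->] := ins_increasing T' rx' xw; have [-> ->] := ins_increasing T rx' xw.
  exists [::], (size w).+1; split=> //=.
  apply/negbTE; rewrite mem_cat mem_rcons inE gtn_eqF //=; apply/norP; split.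
    by apply/negP => /(allP rx); rewrite leqNgt xM.
  by apply/negP => /(allP wM); rewrite /= ltnn.
have /= := entries_below_insert rTM xM; rewrite rE rM //.
case: tab_insert => T' k /= TM'.
have [R [l [-> R1 -> eqi eqM]]] := IHw r' T' TM' wM wS.
by exists (k.+1 :: R), l; split.
Qed.

Definition two_rowed n (s : 'S_n) := all (leq^~ 1) (ins_rows [:: [::]] (word s)).

Lemma word_lift_perm n (p : 'I_n.+1) (s : 'S_n) :
  word (lift_perm p ord_max s) = take p (word s) ++ n :: drop p (word s).
Proof.
have szw := size_word s; have le_pn : p <= n by rewrite -ltnS.
have nthw m (t : 'S_m) (i : 'I_m) : nth 0 (word t) i = t i.
  by rewrite (nth_map i) ?size_enum_ord // nth_ord_enum.
have eqs : size (word (lift_perm p ord_max s))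
         = size (take p (word s) ++ n :: drop p (word s)).
  by rewrite size_cat /= addnS -size_cat cat_take_drop szw size_word.
apply: (@eq_from_nth _ 0 _ _ eqs) => i; rewrite size_word => lt_i.
rewrite -[i]/(nat_of_ord (Ordinal lt_i)).
move: (Ordinal lt_i) => {i lt_i} j; rewrite nthw nth_cat size_takel ?szw //.
case: (unliftP p j) => [{}j|] ->; last by rewrite lift_perm_id ltnn subnn.
rewrite lift_perm_lift /= /bump; rewrite [n <= _]leqNgt ltn_ord add0n.
have [le_pj|lt_jp] := leqP p j.
  by rewrite ltnNge ltnW //= subSn //= nth_drop subnKC // nthw.
by rewrite add0n lt_jp nth_take // nthw.
Qed.

Lemma Psi_lift_perm n (p : 'I_n.+1) (s : 'S_n) :
  two_rowed s -> sorted ltn (drop p (word s)) ->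
  two_rowed (lift_perm p ord_max s) /\
  exists A B k l,
  [/\ size A = n, k + l = n - p,
      Psi s = A ++ nseq k false ++ nseq l true ++ B
    & Psi (lift_perm p ord_max s)
      = A ++ nseq k false ++ nseq l true ++ true :: false :: B].
Proof.
have le_pn : p <= n by rewrite -ltnS.
have iotaS : iota 0 n.+1 = rcons (iota 0 n) n by rewrite -addn1 iotaD cats1.
rewrite /two_rowed !PsiE word_lift_perm iotaS map_rcons; have szw := size_word s.
have := cat_take_drop p (word s).
have : all (ltn^~ n) (word s) by apply/allP=> i /mapP[j _ ->] /=.
have : size (drop p (word s)) = n - p by rewrite size_drop szw.
move: (take p _) (drop p _) => w1 w2 szw2 wn wE; rewrite -wE.
move: wn; rewrite -wE all_cat => /andP[w1n w2n].
rewrite !ins_rows_cat !ins_tab_cat all_cat => /andP[R1le R2le] w2S.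
have [r [T TE]] := ins_tab_cons [::] [::] w1.
have rTM : entries_below n (r :: T) by rewrite -TE entries_below_ins_tab.
have rME : row_insert r n = (rcons r n, None).
  have /andP[rn _] := rTM; rewrite row_insert_append //.
  by apply: sub_all rn => y; apply: ltnW.
have [R [k [RE R_ge1 RME eqi eqn]]] := ins_after_max rTM w2n w2S.
move: R2le; rewrite !TE /= !rME /= RE RME all_cat => /andP[R_le1 _].
have szR : size R + k = n - p by rewrite -szw2 -(size_ins_rows (r :: T) w2) RE size_cat size_nseq.
have R1 : R = nseq (size R) 1.
  by apply/all_pred1P/allP => i iR /=; have := allP R_le1 _ iR; have := allP R_ge1 _ iR; lia.
split.
  rewrite all_cat R1le /= all_cat R_le1 /=; case: k {RE RME eqn szR} => //= k.
  by apply/allP => i /nseqP[->].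
exists [seq i \in nth [::] (ins_tab (r :: T) w2) 0 | i <- iota 0 n].
exists (rev [seq k == 1 | k <- ins_rows [:: [::]] w1]), k, (size R).
split; first by rewrite size_map size_iota.
- by rewrite addnC.
- by rewrite !map_cat !rev_cat R1 !map_nseq !rev_nseq size_nseq -!catA.
rewrite eqn cat_rcons; congr (_ ++ _).
  by apply/eq_in_map => i; rewrite mem_iota => /andP[_]; apply: eqi.
rewrite !map_cat !rev_cat /= rev_cons map_cat rev_cat R1 map_nseq rev_nseq size_nseq /=.
have shift j C : nseq j true ++ true :: C = true :: nseq j true ++ C.
  by elim: j => //= j ->.
rewrite -cats1 -!catA shift /=; case: k {RE RME eqn szR} => //= k.
by rewrite rev_cons map_nseq rev_nseq -cats1 -!catA /=; elim: k => //= k <-.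
Qed.

Lemma ups_beforeS D p : p < size D ->
  ups_before D p.+1 = ups_before D p + nth false D p.
Proof.
by move=> lt_p; rewrite /ups_before (take_nth false) // -cats1 count_cat /= eqb_id addn0.
Qed.

Lemma downs_beforeS D p : p < size D ->
  downs_before D p.+1 = downs_before D p + ~~ nth false D p.
Proof.
move=> lt_p; rewrite /downs_before (take_nth false) // -cats1 count_cat /= addn0.
by case: nth.
Qed.

Lemma ups_downs_before D p : p <= size D -> ups_before D p + downs_before D p = p.
Proof.
elim: p => [|p IHp] le_p; first by rewrite /ups_before /downs_before take0.
by rewrite ups_beforeS // downs_beforeS //; have := IHp (ltnW le_p); case: nth; lia.
Qed.

Lemma leq_ups_before D p q : p <= q -> ups_before D p <= ups_before D q.
Proof.
by move=> /subnKC <-; rewrite /ups_before takeD count_cat leq_addr.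
Qed.

Lemma leq_downs_before D p q : p <= q -> downs_before D p <= downs_before D q.
Proof.
by move=> /subnKC <-; rewrite /downs_before takeD count_cat leq_addr.
Qed.

Lemma ups_before_lt_count D p : is_up D p -> ups_before D p < count_mem true D.
Proof.
case/andP=> lt_p up_p; have := leq_ups_before D lt_p.
by rewrite ups_beforeS // up_p addn1 {2}/ups_before take_size.
Qed.

Lemma head_filter_iota (P : pred nat) d j l q : j <= q < j + l -> P q ->
  (forall r, j <= r < q -> ~~ P r) -> head d [seq r <- iota j l | P r] = q.
Proof.
case/andP=> le_jq lt_q Pq minq.
have -> : l = (q - j) + (l - (q - j)).-1.+1 by lia.
rewrite iotaD filter_cat (@eq_in_filter _ _ pred0) ?filter_pred0 /= ?subnKC ?Pq //.
by move=> r; rewrite mem_iota subnKC // => /minq/negbTE.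
Qed.

Definition tunnel (D : seq bool) (p q : nat) : Prop :=
  [/\ p < q < size D, nth false D p, ~~ nth false D q,
      ups_before D q.+1 + downs_before D p = ups_before D p + downs_before D q.+1
    & forall r, p < r <= q ->
        ups_before D p + downs_before D r < ups_before D r + downs_before D p].

Lemma mate_tunnel D p q : tunnel D p q -> mate D p = q.
Proof.
case=> /andP[lt_pq lt_q] _ down_q hq above.
apply: head_filter_iota; first by lia.
  by rewrite /is_down lt_q down_q /=; apply/eqP; rewrite /height; lia.
move=> r /andP[lt_pr lt_rq]; apply/negP => /andP[_ /eqP].
by rewrite /height; have := above r.+1; lia.
Qed.

Lemma up_pos_label n D p : count_mem true D = n -> is_up D p ->
  up_pos n D (up_label n D p) = p.
Proof.
move=> cD up_p; have := ups_before_lt_count up_p; rewrite cD => lt_n.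
have /andP[lt_p _] := up_p.
apply: head_filter_iota => [||r /andP[_ lt_rp]]; first by rewrite lt_p.
  by rewrite up_p eqxx.
apply/negP => /andP[/andP[lt_r up_r]]; rewrite /up_label.
by have := leq_ups_before D lt_rp; rewrite ups_beforeS // up_r; lia.
Qed.

Definition matching n D (t : 'S_n) (x y : 'I_n -> nat) : Prop :=
  forall c : 'I_n, [/\ tunnel D (x c) (y c), up_label n D (x c) = c
                     & down_label D (y c) = t c].

Lemma Phi_inv_matching n D (t : 'S_n) x y :
  count_mem true D = n -> matching D t x y -> Phi_inv n D = t.
Proof.
move=> cD tD; rewrite /Phi_inv.
suff -> : [ffun i : 'I_n => insubd i (Phi_inv_val n D i)] = val t by rewrite valKd.
apply/ffunP => c; rewrite ffunE; have -> : val t c = t c by rewrite -pvalE.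
have [tun lab_x lab_y] := tD c; have [/andP[lt_xy lt_y] up_x _ _ _] := tun.
have up_xc : is_up D (x c) by rewrite /is_up up_x (ltn_trans lt_xy).
by rewrite /Phi_inv_val -{1}lab_x up_pos_label // (mate_tunnel tun) lab_y valKd.
Qed.

Section InsertPeak.

Variables D1 D2 : seq bool.
Let D := D1 ++ D2.
Let E := D1 ++ [:: true, false & D2].
Let m := size D1.

Lemma ups_before_peakl r : r <= m -> ups_before E r = ups_before D r.
Proof. by move=> le_rm; rewrite /ups_before !takel_cat. Qed.

Lemma downs_before_peakl r : r <= m -> downs_before E r = downs_before D r.
Proof. by move=> le_rm; rewrite /downs_before !takel_cat. Qed.

Lemma ups_before_peak : ups_before E m.+1 = (ups_before D m).+1.
Proof.
by rewrite /ups_before !take_cat -/m ltnn ltnNge leqnSn subnn subSnn !count_cat /= addn1 take0 addn0.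
Qed.

Lemma downs_before_peak : downs_before E m.+1 = downs_before D m.
Proof.
by rewrite /downs_before !take_cat -/m ltnn ltnNge leqnSn subnn subSnn !count_cat /= take0 !addn0.
Qed.

Lemma ups_before_peakr r : m <= r -> ups_before E r.+2 = (ups_before D r).+1.
Proof.
move=> le_mr; have [lt_r lt_r2] : (r < m) = false /\ (r.+2 < m) = false by lia.
by rewrite /ups_before !take_cat -/m lt_r lt_r2 !subSn ?leqW // !count_cat /= -addnS.
Qed.

Lemma downs_before_peakr r : m <= r -> downs_before E r.+2 = (downs_before D r).+1.
Proof.
move=> le_mr; have [lt_r lt_r2] : (r < m) = false /\ (r.+2 < m) = false by lia.
by rewrite /downs_before !take_cat -/m lt_r lt_r2 !subSn ?leqW // !count_cat /= -addnS.
Qed.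

Definition peak_shift r := if r < m then r else r.+2.

Lemma nth_peak_shift r : nth false E (peak_shift r) = nth false D r.
Proof.
rewrite /peak_shift /E /D !nth_cat -/m; have [lt_rm|le_mr] := ltnP r m.
  by rewrite lt_rm.
by rewrite !ltnNge !leqW //= !subSn ?leqW.
Qed.

Lemma height_peak_shift r : ups_before E (peak_shift r) + downs_before D r
  = ups_before D r + downs_before E (peak_shift r).
Proof.
rewrite /peak_shift; have [lt_rm|le_mr] := ltnP r m.
  by rewrite ups_before_peakl ?downs_before_peakl // ltnW.
by rewrite ups_before_peakr ?downs_before_peakr //; lia.
Qed.

Lemma height_peak_shiftS r :
  ups_before E (peak_shift r).+1 + downs_before D r.+1
  = ups_before D r.+1 + downs_before E (peak_shift r).+1.
Proof.
rewrite /peak_shift; have [lt_rm|le_mr] := ltnP r m.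
  by rewrite ups_before_peakl ?downs_before_peakl.
by rewrite ups_before_peakr ?downs_before_peakr ?leqW //; lia.
Qed.

Lemma tunnel_peak_shift p q : tunnel D p q -> tunnel E (peak_shift p) (peak_shift q).
Proof.
case=> /andP[lt_pq lt_q] up_p down_q hq above.
have szE : size E = (size D).+2 by rewrite !size_cat /= !addnS.
split; rewrite ?nth_peak_shift //.
- by rewrite szE /peak_shift; case: (ltnP p m); case: (ltnP q m); lia.
- by have := height_peak_shift p; have := height_peak_shiftS q; lia.
move=> r pr; have hp := height_peak_shift p.
have Ur s : p < s <= q ->
   ups_before E r + downs_before D s = ups_before D s + downs_before E r
   -> ups_before E (peak_shift p) + downs_before E r
      < ups_before E r + downs_before E (peak_shift p).
  by move=> /above; lia.
have [le_rm|lt_mr] := leqP r m.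
  apply: (Ur r); first by move: pr; rewrite /peak_shift; case: (ltnP p m); case: (ltnP q m); lia.
  by rewrite ups_before_peakl // downs_before_peakl //; lia.
have [eq_r|ne_r] := eqVneq r m.+1.
  have /above : p < m <= q by move: pr; rewrite /peak_shift; case: (ltnP p m); case: (ltnP q m); lia.
  by rewrite eq_r ups_before_peak downs_before_peak; lia.
have [s r_s] : exists s, r = s.+2 by exists r.-2; lia.
have le_ms : m <= s by lia.
rewrite r_s in Ur pr *; apply: (Ur s).
  by move: pr; rewrite /peak_shift; case: (ltnP p m); case: (ltnP q m); lia.
by rewrite ups_before_peakr // downs_before_peakr //; lia.
Qed.

Lemma tunnel_peak : tunnel E m m.+1.
Proof.
have := ups_before_peakr (leqnn m); have := downs_before_peakr (leqnn m).
have := ups_before_peak; have := downs_before_peak.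
have := ups_before_peakl (leqnn m); have := downs_before_peakl (leqnn m).
move=> Ud Uu Vd Vu Wd Wu.
split; rewrite /= ?nth_cat -/m ?ltnn ?subnn ?ltnNge ?leqnSn ?subSnn //.
- by rewrite size_cat /= -/m; lia.
- by lia.
move=> r r_m; have -> : r = m.+1 by lia.
by lia.
Qed.

Lemma matching_peak n (t : 'S_n) x y (a b : 'I_n.+1) :
    matching D t x y -> count_mem true D = n ->
    n = a + ups_before D m -> b = downs_before D m :> nat ->
  matching E (lift_perm a b t)
    (fun c => if unlift a c is Some c' then peak_shift (x c') else m)
    (fun c => if unlift a c is Some c' then peak_shift (y c') else m.+1).
Proof.
move=> tD cD aE bE c; case: (unliftP a c) => [c'|] ->; last first.
  rewrite lift_perm_id; split; first exact: tunnel_peak.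
    by rewrite /up_label ups_before_peakl //; lia.
  by rewrite /down_label downs_before_peak.
have [tun lab_x lab_y] := tD c'.
have [/andP[lt_xy lt_y] up_x down_y _ _] := tun.
have := ups_before_lt_count (D := D) (p := x c'); rewrite /is_up up_x (ltn_trans lt_xy) // cD.
move=> /(_ isT) lt_u.
rewrite lift_perm_lift; split; first exact: tunnel_peak_shift.
  move: lab_x; rewrite /up_label /peak_shift /= /bump.
  have [lt_xm|le_mx] := ltnP (x c') m.
    have := leq_ups_before D lt_xm; rewrite ups_beforeS ?up_x ?(ltn_trans lt_xy) //.
    by rewrite ups_before_peakl ?(ltnW lt_xm) //; lia.
  by have := leq_ups_before D le_mx; rewrite ups_before_peakr //; lia.
move: lab_y; rewrite /down_label /peak_shift /= /bump => <-.
have [lt_ym|le_my] := ltnP (y c') m.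
  have := leq_downs_before D lt_ym; rewrite downs_beforeS // down_y.
  by rewrite downs_before_peakl ?(ltnW lt_ym) //; lia.
by have := leq_downs_before D le_my; rewrite downs_before_peakr //; lia.
Qed.

End InsertPeak.

Lemma lift_permP n (s : 'S_n.+1) i : exists s' : 'S_n, s = lift_perm i (s i) s'.
Proof.
have sE k : {j | s (lift i k) = lift (s i) j}.
  have ne : s i != s (lift i k) by rewrite (inj_eq perm_inj) neq_lift.
  by have [j -> _] := unlift_some ne; exists j.
have f_inj : injective (fun k => sval (sE k)).
  move=> k l /= eq_kl; apply: (@lift_inj _ i); apply: (@perm_inj _ s).
  by rewrite (svalP (sE k)) (svalP (sE l)) eq_kl.
exists (perm f_inj); apply/permP => k.
case: (unliftP i k) => [j|] ->; last by rewrite lift_perm_id.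
by rewrite lift_perm_lift permE; apply: svalP (sE j).
Qed.

Lemma avoids321_lift_perm n (p : 'I_n.+1) (s : 'S_n) :
  avoids pat321 (lift_perm p ord_max s) -> avoids pat321 s.
Proof.
move=> av [f [f_mono f_pat]]; apply: av; exists (fun c => lift p (f c)); split.
  by move=> c d /f_mono; rewrite /= /bump; lia.
move=> c d; rewrite !lift_perm_lift -f_pat /= /bump.
by rewrite ![n <= _]leqNgt !ltn_ord.
Qed.

Lemma avoids321_after_max n (p : 'I_n.+1) (s : 'S_n) :
  avoids pat321 (lift_perm p ord_max s) ->
  forall i j : 'I_n, p <= i -> i < j -> s i < s j.
Proof.
move=> av i j le_pi lt_ij; have [//|le_ji] := ltnP; case: av.
have lt_ji : s j < s i.
  rewrite ltn_neqAle le_ji val_eqE (inj_eq perm_inj) andbT.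
  by rewrite -val_eqE gtn_eqF.
exists (fun c : 'I_3 => nth p [:: p; lift p i; lift p j] c); split.
  by move=> [[|[|[|c]]] //= _] [[|[|[|d]]] //= _] //; rewrite /bump; lia.
move=> [[|[|[|c]]] //= hc] [[|[|[|d]]] //= hd] //;
  rewrite ?lift_perm_id ?lift_perm_lift !permE /= /bump ?[n <= _]leqNgt ?ltn_ord /=;
  have := ltn_ord (s i); have := ltn_ord (s j); lia.
Qed.

Lemma increasing_tail_le n p (s : 'S_n) :
  (forall i j : 'I_n, p <= i -> i < j -> s i < s j) ->
  forall i : 'I_n, p <= i -> s i <= i.
Proof.
move=> incr i; move: {-1}(n - i) (leqnn (n - i)) => d.
elim: d i => [|d IHd] i le_d le_pi; first by have := ltn_ord i; lia.
have [lt_i|le_n] := ltnP i.+1 n; last by have := ltn_ord (s i); lia.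
have /= := incr i (Ordinal lt_i) le_pi (leqnn _).
by have /= := IHd (Ordinal lt_i); lia.
Qed.

Lemma sorted_drop_word n p (s : 'S_n) :
  (forall i j : 'I_n, p <= i -> i < j -> s i < s j) ->
  sorted ltn (drop p (word s)).
Proof.
move=> incr; apply/(sortedP 0) => i; rewrite size_drop size_word !nth_drop => lt_i.
have nthw (k : 'I_n) : nth 0 (word s) k = s k.
  by rewrite (nth_map k) ?size_enum_ord // nth_ord_enum.
have lt1 : p + i < n by lia.
have lt2 : p + i.+1 < n by lia.
rewrite (nthw (Ordinal lt1)) (nthw (Ordinal lt2)).
by apply: incr => /=; lia.
Qed.

Lemma tunnel_balance D p q : tunnel D p q ->
  ups_before D q + downs_before D p = (ups_before D p + downs_before D q).+1
  /\ p + q = ((ups_before D p + downs_before D q).*2).+1.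
Proof.
case=> /andP[lt_pq lt_q] up_p down_q hq _.
have := ups_downs_before (ltnW lt_q).
have := ups_downs_before (ltnW (ltn_trans lt_pq lt_q)).
by move: hq; rewrite ups_beforeS // downs_beforeS // (negbTE down_q); lia.
Qed.

(* After its middle the path first goes down [k] times, then up: a tunnel closed
   before the end of this stretch cannot have its midpoint in the right half. *)
Lemma tunnel_left_half n k l A B p q (D := A ++ nseq k false ++ nseq l true ++ B) :
  size A = n -> tunnel D p q -> q < n + k + l -> p + q < n.*2.
Proof.
move=> szA tun lt_q; have [/andP[lt_pq lt_qD] up_p down_q _ _] := tun.
have [lt_qn|le_nq] := ltnP q n; first by lia.
have nthD r : n <= r < n + k + l -> nth false D r = (n + k <= r).
  move=> /andP[le_nr lt_r]; rewrite /D nth_cat szA ltnNge le_nr /= nth_cat size_nseq.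
  have [lt_rk|le_kr] := ltnP (r - n) k; first by rewrite nth_nseq lt_rk; lia.
  have lt_rl : r - n - k < l by lia.
  by rewrite nth_cat size_nseq nth_nseq lt_rl; lia.
have lt_qk : q < n + k by move: down_q; rewrite nthD; lia.
have lt_pn : p < n by case: (ltnP p n) => // le_np; move: up_p; rewrite nthD; lia.
have flat r : n + r <= q -> ups_before D (n + r) = ups_before D n.
  elim: r => [|r IHr]; first by rewrite addn0.
  by rewrite addnS => lt_r; rewrite ups_beforeS ?nthD ?IHr; lia.
have := flat (q - n); rewrite subnKC // => /(_ (leqnn _)).
have := tunnel_balance tun; have := leq_downs_before D (ltnW lt_pn).
have := @ups_downs_before D n; rewrite size_cat szA leq_addr => /(_ isT).
by lia.
Qed.

(* The last clause refines fp by position, since deleting the maximum turns the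
   points s i = i - 1 with i > p into fixed points. *)
Lemma Theta_invariant n (s : 'S_n) : avoids pat321 s ->
  exists (t : 'S_n) (x y : 'I_n -> nat),
  [/\ two_rowed s, size (Psi s) = n.*2 /\ count_mem true (Psi s) = n,
      matching (Psi s) t x y, exc t = exc s /\ crs t = crs s
    & forall k, \sum_(c < n) ((t c == c) && (x c < k))
              = \sum_(i < n) ((s i == i) && (i < k))].
Proof.
elim: n s => [|n IHn] s av_s.
  have w0 : word s = [::] by apply: size0nil; rewrite size_word.
  exists s, (fun=> 0), (fun=> 0); split=> //.
  - by rewrite /two_rowed w0.
  - by rewrite PsiE w0.
  - by case.
  by move=> k; rewrite !big_ord0.
pose p := (s^-1)%g ord_max.
have [s' sE] := lift_permP s p; rewrite permKV in sE.
move: p sE av_s => p -> {s} av_s.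
have incr := avoids321_after_max av_s.
have s'_tail := increasing_tail_le incr.
have [t [x [y [s'2 [szD cD] tD [exc_t crs_t] fix_t]]]] := IHn _ (avoids321_lift_perm av_s).
have [s2 [A [B [k [l [szA klE DE EE]]]]]] := Psi_lift_perm s'2 (sorted_drop_word incr).
have le_pn : p <= n by rewrite -ltnS.
set D := Psi s' in szD cD tD DE *.
pose D1 := A ++ nseq k false ++ nseq l true; pose m := size D1.
have D1E : D = D1 ++ B by rewrite DE -!catA.
have E1E : Psi (lift_perm p ord_max s') = D1 ++ [:: true, false & B].
  by rewrite EE -!catA.
have mE : m = n + (n - p) by rewrite /m !size_cat !size_nseq szA klE.
have := @ups_downs_before D m; rewrite szD => /(_ ltac:(lia)) udm.
have le_um : ups_before D m <= n.
  by rewrite -cD -[X in _ <= count_mem _ X]take_size; apply: leq_ups_before; lia.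
have le_dm : downs_before D m <= n.
  have ups_all : ups_before D n.*2 = n by rewrite /ups_before -szD take_size.
  have := @ups_downs_before D n.*2; rewrite ups_all szD leqnn => /(_ isT).
  by have := @leq_downs_before D m n.*2; lia.
pose b : 'I_n.+1 := inord (downs_before D m).
pose a : 'I_n.+1 := inord (n - ups_before D m).
have bE : b = downs_before D m :> nat by rewrite inordK.
have aE : n = a + ups_before D m by rewrite inordK; lia.
have abE : b = a + (n - p) :> nat by lia.
have x_lt (c : 'I_n) : (a <= c) = (x c < m).
  have [tun lab_x _] := tD c; have [/andP[lt_xy lt_y] up_x _ _ _] := tun.
  move: lab_x; rewrite /up_label.
  have := ups_before_lt_count (D := D) (p := x c).
  rewrite /is_up up_x (ltn_trans lt_xy) // cD => /(_ isT).
  have [lt_xm|le_mx] := ltnP (x c) m.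
    have := leq_ups_before D lt_xm; rewrite ups_beforeS ?(ltn_trans lt_xy) // up_x.
    by lia.
  by have := leq_ups_before D le_mx; lia.
have y_lt (c : 'I_n) : (t c < b) = (y c < m).
  have [tun _ <-] := tD c; have [/andP[lt_xy lt_y] _ down_y _ _] := tun.
  rewrite bE /down_label; have [lt_ym|le_my] := ltnP (y c) m.
    by have := leq_downs_before D lt_ym; rewrite downs_beforeS // down_y addn1.
  by have := leq_downs_before D le_my; lia.
have midpoint (c : 'I_n) : (t c + n).*2 = c.*2 + (x c + y c).+1.
  have [tun lab_x lab_y] := tD c; have [/andP[lt_xy lt_y] up_x _ _ _] := tun.
  have [_ ->] := tunnel_balance tun.
  move: lab_x lab_y; rewrite /up_label /down_label.
  have := ups_before_lt_count (D := D) (p := x c).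
  rewrite /is_up up_x (ltn_trans lt_xy) // cD => /(_ isT).
  by lia.
have below (c : 'I_n) : a <= c -> t c < b -> t c <= c.
  rewrite y_lt => _ lt_ym; have [tun _ _] := tD c; rewrite DE in tun.
  have := tunnel_left_half szA tun; rewrite -addnA klE -mE => /(_ lt_ym).
  by have := midpoint c; lia.
have below_s (i : 'I_n) : p <= i -> s' i < (ord_max : 'I_n.+1) -> s' i <= i.
  by move=> le_pi _; apply: s'_tail.
have le_ab : a <= b by lia.
have le_p_max : p <= (ord_max : 'I_n.+1) by [].
exists (lift_perm a b t).
exists (fun c => if unlift a c is Some c' then peak_shift D1 (x c') else m).
exists (fun c => if unlift a c is Some c' then peak_shift D1 (y c') else m.+1).
rewrite E1E; split=> //.
- have := congr1 size D1E; have := congr1 (count_mem true) D1E.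
  by rewrite szD cD !size_cat !count_cat /=; lia.
- by apply: matching_peak; rewrite -?D1E.
- rewrite !exc_lift_perm // !crs_lift_perm // exc_t crs_t abE /=.
  by split; [congr (_ + _); lia | lia].
move=> j; rewrite (bigD1_ord a) // [RHS](bigD1_ord p) //=.
rewrite !lift_perm_id unlift_none -!val_eqE /=; congr (_ + _); first by lia.
transitivity (\sum_(c < n) ((t c == c) && (x c < minn j p))).
  apply: eq_bigr => c _; rewrite fixed_lift_perm // liftK.
  have [/eqP tc|//] := boolP (t c == c); rewrite /=.
  have [tun _ _] := tD c; have [/andP[lt_xy lt_y] _ _ _ _] := tun.
  have := x_lt c; have := y_lt c; have := midpoint c; rewrite tc.
  by rewrite /peak_shift -/m; case: (ltnP (x c) m); lia.
rewrite fix_t; apply: eq_bigr => i _; rewrite fixed_lift_perm //=.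
rewrite /bump [n <= i]leqNgt ltn_ord orbF.
by case: (s' i == i) => //=; have := ltn_ord i; case: (leqP p i); lia.
Qed.

Theorem theorem3p3 (n : nat) (hn : 0 < n) (s : 'S_n) (hs : avoids pat321 s) :
  (fp (Theta s), exc (Theta s), crs (Theta s)) = (fp s, exc s, crs s).
Proof.
have [t [x [y [_ [szD cD] tD [exc_t crs_t] fix_t]]]] := Theta_invariant hs.
rewrite /Theta (Phi_inv_matching cD tD) exc_t crs_t; congr (_, _, _).
rewrite !fp_sum; transitivity (\sum_(c < n) ((t c == c) && (x c < n.*2))).
  apply: eq_bigr => c _; have [[/andP[lt_xy lt_y] _ _ _ _] _ _] := tD c.
  by rewrite -szD (ltn_trans lt_xy) // andbT.
rewrite fix_t; apply: eq_bigr => i _.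
by rewrite -addnn (leq_trans (ltn_ord i)) ?leq_addr // andbT.
Qed.
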